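(* Let $H$ be a $2$-edge-connected cubic multigraph that is not isomorphic to $S_2$, $K_4$ or $K_{3,3}$. Then $H$ is decomposable, i.e. $H$ has a matching whose removal increases the number of connected components.
   Context: A multigraph may have parallel edges and loops; it is cubic if every vertex has degree $3$ (a loop counting $2$). $S_2$ denotes the unique cubic multigraph on two vertices (two vertices joined by three parallel edges). A matching is a set of pairwise vertex-disjoint non-loop edges. A multigraph is decomposable if it has a matching whose removal increases the number of connected components. *)

(* Defs.v *)
From mathcomp Require Import all_boot.

Set Implicit Arguments.
Unset Strict Implicit.
Unset Printing Implicit Defensive.

(* The edge type is separate from the vertex type, so parallel edges are        *)
(* distinct edges with the same ends; a loop is an edge with exactly one end.   *)
Record multigraph := Multigraph {
  vertex : finType;
  edge : finType;
  ends : edge -> {set vertex};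
  ends_card : forall e, 0 < #|ends e| <= 2
}.

Definition is_loop (G : multigraph) (e : edge G) : bool := #|ends e| == 1.

Definition degree (G : multigraph) (v : vertex G) : nat :=
  \sum_(e : edge G | v \in ends e) (if is_loop e then 2 else 1).

Definition cubic (G : multigraph) : Prop := forall v : vertex G, degree v = 3.

Definition adj (G : multigraph) : rel (vertex G) :=
  [rel x y | [exists e : edge G, ends e == [set x; y]]].

(* n_comp counts connected components only because adj is symmetric. *)
Lemma adj_sym (G : multigraph) : symmetric (@adj G).
Proof. by move=> x y; apply: eq_existsb => e; rewrite setUC. Qed.

Definition num_components (G : multigraph) : nat := n_comp (@adj G) predT.

Definition connected (G : multigraph) : Prop := num_components G = 1.

Definition delete_edges (G : multigraph) (F : {set edge G}) : multigraph :=
  @Multigraph (vertex G) {e : edge G | e \notin F}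
    (fun e => ends (val e)) (fun e => ends_card (val e)).

Definition edge_connected (k : nat) (G : multigraph) : Prop :=
  1 < #|vertex G| /\
  forall F : {set edge G}, #|F| < k -> connected (delete_edges F).

Definition matching (G : multigraph) (M : {set edge G}) : Prop :=
  (forall e, e \in M -> ~~ is_loop e) /\
  {in M &, forall e f, e != f -> [disjoint ends e & ends f]}.

Definition decomposable (G : multigraph) : Prop :=
  exists2 M : {set edge G},
    matching M & num_components G < num_components (delete_edges M).

Definition isomorphic (G H : multigraph) : Prop :=
  exists (f : vertex G -> vertex H) (g : edge G -> edge H),
    [/\ bijective f, bijective g & forall e, ends (g e) = f @: ends e].

Lemma S2_ends_card (e : 'I_3) : 0 < #|[set: 'I_2]| <= 2.
Proof. by rewrite cardsT card_ord. Qed.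

Definition S2 : multigraph := Multigraph S2_ends_card.

Lemma complete_ends_card n (e : {A : {set 'I_n} | #|A| == 2}) :
  0 < #|val e| <= 2.
Proof. by rewrite (eqP (valP e)). Qed.

Definition complete_graph (n : nat) : multigraph :=
  Multigraph (@complete_ends_card n).

Lemma complete_bipartite_ends_card m n (e : 'I_m * 'I_n) :
  0 < #|[set (inl e.1 : 'I_m + 'I_n); inr e.2]| <= 2.
Proof. by rewrite cards2. Qed.

Definition complete_bipartite_graph (m n : nat) : multigraph :=
  Multigraph (@complete_bipartite_ends_card m n).

(* Main.v *)
Require Import Defs.
From mathcomp Require Import all_boot.
From mathcomp Require Import zify.

Set Implicit Arguments.
Unset Strict Implicit.
Unset Printing Implicit Defensive.

(** Call a vertex set good if each of its vertices meets at most one boundary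
    edge.  If a good set is nonempty and proper and its boundary is not a
    matching, some outside vertex meets at least two boundary edges; absorbing
    it keeps the set good and, the graph being cubic, strictly shrinks the
    boundary.  A proper good set with at most two boundary edges thus always
    leads to a matching cut, and starting from a good set with g vertices
    (hence at most g boundary edges) one fails only if there are at most 2g-2
    vertices.  Loops and pairs of parallel edges give good sets of size 1 and
    2, where only S2 escapes.  Otherwise take a shortest cycle, of length g: an
    outside vertex with two neighbours on it would close two cycles of total
    length g + 4, so for g >= 5 its boundary is already a matching; g = 3
    leaves only K4, and g = 4 only triangle-free cubic graphs on six vertices,
    i.e. K33. *)

(** * Edge boundaries, matching cuts and loops *)

Definition incident (G : multigraph) (v : vertex G) : {set edge G} :=
  [set e | v \in ends e].

Definition boundary (G : multigraph) (S : {set vertex G}) : {set edge G} :=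
  [set e | ~~ (ends e \subset S) & ~~ [disjoint ends e & S]].

Definition neighbours (G : multigraph) (v : vertex G) : {set vertex G} :=
  [set w | adj v w].

Definition loopless (G : multigraph) := forall e : edge G, ~~ is_loop e.

Definition good (G : multigraph) (S : {set vertex G}) :=
  forall v, v \in S -> #|incident v :&: boundary S| <= 1.

(** An edge has at most two ends, so one end inside and one outside exhaust it; a loop never
    crosses. *)
Lemma boundaryP (G : multigraph) (S : {set vertex G}) (e : edge G) :
  reflect (exists x y, [/\ ends e = [set x; y], x \in S & y \notin S])
          (e \in boundary S).
Proof.
rewrite inE; apply: (iffP andP) => [[/subsetPn[y ye yS]]|[x [y [-> xS yS]]]].
  rewrite -setI_eq0 => /set0Pn[x /setIP[xe xS]]; exists x, y; split=> //.
  have xy : x != y by apply: contraNneq yS => <-.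
  apply/esym/eqP; rewrite eqEcard cards2 xy subUset !sub1set xe ye.
  by case/andP: (ends_card e).
split; first by apply/subsetPn; exists y; rewrite ?inE ?eqxx ?orbT.
by rewrite -setI_eq0; apply/set0Pn; exists x; rewrite !inE eqxx xS.
Qed.

Lemma loopless_ends (G : multigraph) (e : edge G) (x : vertex G) :
  ~~ is_loop e -> x \in ends e -> exists2 y, y != x & ends e = [set x; y].
Proof.
rewrite /is_loop => el xe; have ec := ends_card e.
have /cards2P[a [b [ab eE]]] : #|ends e| == 2 by lia.
move: xe; rewrite eE !inE => /orP[]/eqP->.
  by exists b => //; rewrite eq_sym.
by exists a => //; rewrite setUC.
Qed.

(** The bound ranges over the vertices on both sides, so crossing edges are pairwise disjoint.
    Deleting them makes [S] closed under adjacency, hence cut off from its complement. *)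
Lemma boundary_decomposable (G : multigraph) (S : {set vertex G}) :
  connected G -> S != set0 -> S != setT ->
  (forall v, #|incident v :&: boundary S| <= 1) -> decomposable G.
Proof.
move=> Gc /set0Pn[x xS]; rewrite -subTset => /subsetPn[y _ yS] le1.
exists (boundary S).
  split=> [e /boundaryP[a [b [eE aS bS]]]|e f eB fB ef].
    have ab : a != b by apply: contraNneq bS => <-.
    by rewrite /is_loop eE cards2 ab.
  rewrite -setI_eq0; apply: contraT => /set0Pn[v /setIP[ve vf]].
  case/negP: ef; apply/eqP.
  by apply: (card_le1_eqP (le1 v)); rewrite in_setI inE ?ve ?vf.
rewrite Gc; set D := delete_edges _.
have Dsym : connect_sym (@adj D) by apply: sym_connect_sym; apply: adj_sym.
have cl : closed (@adj D) (mem S).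
  apply: intro_closed => // a b /existsP[e /eqP eE] aS.
  apply: contraNT (valP e) => bS; apply/boundaryP; exists a, b.
  by split.
have rxy : root (@adj D) x != root (@adj D) y.
  apply/eqP => /(rootP Dsym) cxy.
  by have : (x \in S) = (y \in S) := closed_connect cl cxy; rewrite xS (negPf yS).
(* Two distinct roots give at least two components, against one in [G]. *)
rewrite /num_components /n_comp_mem.
rewrite (cardD1 (root (@adj D) x)) (cardD1 (root (@adj D) y)) !inE.
by rewrite !(roots_root Dsym) (eq_sym (root _ y)) rxy.
Qed.

Lemma card_incident (G : multigraph) (v : vertex G) :
  cubic G -> loopless G -> #|incident v| = 3.
Proof.
move=> Gc Gl; rewrite -(Gc v) /degree -sum1_card.
rewrite (eq_bigl (fun e : edge G => v \in ends e)) => [|e]; last by rewrite inE.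
by apply: eq_bigr => e _; rewrite (negPf (Gl e)).
Qed.

(** The loop takes two of the three units of degree at its vertex, so at most one edge leaves that
    vertex. *)
Lemma loop_decomposable (G : multigraph) (e : edge G) :
  connected G -> 1 < #|vertex G| -> cubic G -> is_loop e -> decomposable G.
Proof.
move=> Gc V2 G3 /[dup] el /cards1P[v eE].
have le1 : #|boundary [set v]| <= 1.
  have sub : boundary [set v] \subset incident v :\ e.
    apply/subsetP => f /boundaryP[x [y [fE]]]; rewrite !inE => /eqP xv yv; subst x.
    rewrite fE !inE eqxx andbT; apply: contraNneq yv => fe.
    by move/setP: fE => /(_ y); rewrite fe eE !inE eqxx orbT => ->.
  apply: leq_trans (subset_leq_card sub) _.
  have := G3 v; rewrite /degree (bigD1 e) /=; last by rewrite eE inE.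
  rewrite el => [[d1]]; rewrite -sum1_card -[X in _ <= X]d1 add0n.
  rewrite [X in _ <= X](eq_bigl (fun f => f \in incident v :\ e)); last first.
    by move=> f; rewrite !inE andbC.
  by apply: leq_sum => f _; case: ifP.
apply: (@boundary_decomposable _ [set v]) => //.
- by apply/set0Pn; exists v; rewrite inE.
- by apply: contraTneq V2 => vT; rewrite -cardsT -vT cards1.
- by move=> w; apply: leq_trans le1; apply/subset_leq_card/subsetIr.
Qed.

(** * Absorbing vertices into good sets *)

Lemma card_boundary_good (G : multigraph) (S : {set vertex G}) :
  good S -> #|boundary S| <= #|S|.
Proof.
move=> Sg; rewrite -!sum1_card.
(* Double count the pairs of a boundary edge and an end of it in [S]. *)
apply: (@leq_trans (\sum_(e in boundary S) \sum_(v in S) (v \in ends e))).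
  apply: leq_sum => e /boundaryP[x [y [eE xS yS]]].
  by rewrite (bigD1 x) //= eE !inE eqxx.
rewrite exchange_big /=; apply: leq_sum => v vS; apply: leq_trans (Sg v vS).
rewrite -sum1_card big_mkcond [X in _ <= X]big_mkcond /=.
apply: leq_sum => e _; rewrite in_setI [e \in incident v]inE.
by case: (e \in boundary S); case: (v \in ends e).
Qed.

(** Only edges at [w] can change status. A loop at [w] lies in the right-hand side but is never a
    boundary edge, whence an inclusion. *)
Lemma boundary_setU1 (G : multigraph) (S : {set vertex G}) (w : vertex G) :
  w \notin S -> boundary (w |: S) \subset
    (boundary S :\: incident w) :|: (incident w :\: boundary S).
Proof.
move=> wS; apply/subsetP => e /boundaryP[x [y [eE xwS]]].
rewrite !inE negb_or => /andP[yw yS].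
rewrite eE; case: (boolP (w \in [set x; y])) => [|wxy].
  rewrite !inE (eq_sym w y) (negPf yw) orbF => /eqP wx; rewrite orFb andbT.
  rewrite negb_and !negbK.
  apply/orP; right; rewrite -setI_eq0; apply/eqP/setP=> z; rewrite !inE.
  by apply/andP=> -[/orP[]/eqP->]; rewrite -?wx ?(negPf wS) ?(negPf yS).
move: wxy xwS; rewrite !inE negb_or eq_sym => /andP[/negPf-> _] /= xS.
rewrite andbF orbF; apply/andP; split.
  by apply/subsetPn; exists y; rewrite ?inE ?eqxx ?orbT.
by rewrite -setI_eq0; apply/set0Pn; exists x; rewrite !inE eqxx.
Qed.

(** Of the three edges at [w], at least two become internal, so at most one crosses; vertices of [S]
    gain no boundary edge. *)
Lemma good_setU1 (G : multigraph) (S : {set vertex G}) (w : vertex G) :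
  cubic G -> loopless G -> good S -> w \notin S ->
  1 < #|incident w :&: boundary S| -> good (w |: S).
Proof.
move=> G3 Gl Sg wS w2 v; rewrite in_setU1 => /predU1P[->|vS].
  have sub : incident w :&: boundary (w |: S) \subset incident w :\: boundary S.
    apply/subsetP=> e /setIP[we /(subsetP (boundary_setU1 wS))].
    by rewrite in_setU !in_setD we.
  apply: leq_trans (subset_leq_card sub) _.
  have := cardsID (boundary S) (incident w); rewrite card_incident //; lia.
apply: leq_trans (Sg v vS); apply: subset_leq_card; apply/subsetP=> e.
rewrite !inE => /andP[ve /andP[nsub _]]; rewrite ve /=; apply/andP; split.
  by apply: contra nsub => /subset_trans; apply; apply: subsetUr.
by rewrite -setI_eq0; apply/set0Pn; exists v; rewrite inE ve.
Qed.

Lemma card_boundary_setU1 (G : multigraph) (S : {set vertex G}) (w : vertex G) :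
  cubic G -> loopless G -> w \notin S -> 1 < #|incident w :&: boundary S| ->
  #|boundary (w |: S)| < #|boundary S|.
Proof.
move=> G3 Gl wS w2; have := subset_leq_card (boundary_setU1 wS).
have := (leq_card_setU (boundary S :\: incident w) (incident w :\: boundary S)).1.
have := cardsID (boundary S) (incident w); rewrite card_incident //.
have := cardsID (incident w) (boundary S); rewrite setIC; lia.
Qed.

(** Here [d] bounds the absorptions needed to get down to two boundary edges. Each adds one vertex
    and removes at least one boundary edge, so [d] drops by one while [#|S| + d] is kept. *)
Lemma good_decomposable (G : multigraph) (d : nat) (S : {set vertex G}) :
  connected G -> cubic G -> loopless G -> good S -> S != set0 ->
  #|boundary S| <= d.+2 -> #|S| + d < #|vertex G| -> decomposable G.
Proof.
move=> Gc G3 Gl; elim: d S => [|d IHd] S Sg S0 bS ltS.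
all: have ST : S != setT by apply: contraTneq ltS => ->; rewrite cardsT; lia.
all: have [/forallP le1|] := boolP [forall v, #|incident v :&: boundary S| <= 1];
  first exact: boundary_decomposable Gc S0 ST le1.
all: rewrite negb_forall => /existsP[w]; rewrite -ltnNge => w2.
(* Goodness bounds the vertices of [S], so the violation is outside. *)
all: have wS : w \notin S by apply: contraL w2 => /Sg; rewrite -leqNgt.
all: have bT := card_boundary_setU1 G3 Gl wS w2.
all: have T0 : w |: S != set0 by apply/set0Pn; exists w; rewrite setU11.
- have b1 : #|boundary (w |: S)| <= 1 by lia.
  apply: (boundary_decomposable Gc T0) => [|v]; last first.
    by apply: leq_trans b1; apply/subset_leq_card/subsetIr.
  (* If [w] were the last outside vertex, its three edges would all lie in the boundary of [S],
     which has at most two. *)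
  apply/eqP=> /setP TT.
  suff sub : incident w \subset boundary S.
    by have := subset_leq_card sub; rewrite card_incident //; lia.
  apply/subsetP=> e; rewrite inE => we.
  have [y yw eE] := loopless_ends (Gl e) we.
  apply/boundaryP; exists y, w; split; rewrite // 1?setUC //.
  by have := TT y; rewrite !inE (negPf yw).
- apply: (IHd (w |: S)) => //; [exact: good_setU1|lia|].
  by rewrite cardsU1 wS; lia.
Qed.

(** * Parallel edges *)

Lemma good_of_two_edges (G : multigraph) (S : {set vertex G}) :
  cubic G -> loopless G ->
  (forall v, v \in S -> exists e f,
     [/\ e != f, e \in incident v, f \in incident v, ends e \subset S
        & ends f \subset S]) ->
  good S.
Proof.
move=> G3 Gl S2 v /S2[e [f [ef ve vf eS fS]]].
have sub : incident v :&: boundary S \subset incident v :\: [set e; f].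
  apply/subsetP=> g; rewrite !inE => /andP[-> /andP[nsub _]]; rewrite andbT.
  by apply: contra nsub => /orP[]/eqP->.
apply: leq_trans (subset_leq_card sub) _.
have := cardsID [set e; f] (incident v); rewrite card_incident //.
suff -> : incident v :&: [set e; f] = [set e; f] by rewrite cards2 ef; lia.
by apply/setIidPr; rewrite subUset !sub1set ve.
Qed.

Lemma bijective_cast_enum_rank (T : finType) n (cT : #|T| = n) :
  bijective (fun x : T => cast_ord cT (enum_rank x)).
Proof.
apply: inj_card_bij => [x y /cast_ord_inj/enum_rank_inj //|].
by rewrite card_ord cT.
Qed.

(** The two common ends form a good set with at most two boundary edges, and a third vertex is room
    enough. Without one, every edge joins the same two vertices, and degree three leaves three
    edges. *)
Lemma parallel_decomposable (G : multigraph) (e f : edge G) :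
  connected G -> cubic G -> loopless G -> e != f -> ends e = ends f ->
  ~ isomorphic G S2 -> decomposable G.
Proof.
move=> Gc G3 Gl ef eqef nS2.
have e2 : #|ends e| = 2 by have := ends_card e; have := Gl e; rewrite /is_loop; lia.
have Sg : good (ends e).
  by apply: good_of_two_edges => // v ve; exists e, f; rewrite !inE -eqef ve subxx.
have [V2|] := ltnP 2 #|vertex G|.
  apply: (@good_decomposable _ 0 (ends e)) => //; last by rewrite e2; lia.
    by rewrite -card_gt0 e2.
  by have := card_boundary_good Sg; rewrite e2.
move=> V2; case: nS2.
have endsT (g : edge G) : ends g = setT.
  apply/eqP; rewrite eqEcard subsetT cardsT /=.
  apply: leq_trans V2 _.
  by have := ends_card g; have := Gl g; rewrite /is_loop; lia.
have cV : #|vertex G| = 2 by rewrite -cardsT -(endsT e) e2.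
have cE : #|edge G| = 3.
  have /card_gt0P[v ve] : 0 < #|ends e| by rewrite e2.
  have incT : incident v = setT by apply/setP=> g; rewrite inE endsT !inE.
  by rewrite -cardsT -incT card_incident.
exists (fun v => cast_ord cV (enum_rank v)), (fun g => cast_ord cE (enum_rank g)).
split=> [||g]; [exact: bijective_cast_enum_rank|exact: bijective_cast_enum_rank|].
rewrite endsT; apply/esym/setP=> i; rewrite [RHS]inE.
have [h _ hK] := bijective_cast_enum_rank cV.
by apply/imsetP; exists (h i); [rewrite inE|exact/esym/hK].
Qed.

(** * Simple cubic graphs: recognising K4 and K33 *)

Definition simple (G : multigraph) := loopless G /\ injective (@ends G).

Lemma adj_neq (G : multigraph) (x y : vertex G) :
  loopless G -> adj x y -> x != y.
Proof.
move=> Gl /existsP[e /eqP eE]; apply: contraNneq (Gl e) => xy.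
by rewrite /is_loop eE xy setUid cards1.
Qed.

Lemma card_neighbours (G : multigraph) (x : vertex G) :
  cubic G -> simple G -> #|neighbours x| = 3.
Proof.
move=> G3 [Gl Ginj]; rewrite -(card_incident x G3 Gl) -(card_imset _ Ginj).
(* The pairs [[set x; y]] count both the neighbours of [x] and the edges at [x]. *)
have pair_inj : {in neighbours x &, injective (fun y => [set x; y])}.
  move=> y z; rewrite !inE => xy _ /setP/(_ y); rewrite !inE eqxx orbT.
  by rewrite eq_sym (negPf (adj_neq Gl xy)) => /esym/eqP.
rewrite -(card_in_imset pair_inj); congr #|pred_of_set _|.
apply/setP=> A; apply/imsetP/imsetP=> [[y]|[e]]; rewrite inE.
  by case/existsP=> e /eqP eE ->; exists e; rewrite // inE eE !inE eqxx.
move=> xe ->; have [y _ eE] := loopless_ends (Gl e) xe.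
by exists y => //; rewrite inE; apply/existsP; exists e; rewrite eE.
Qed.

(** In a simple graph an edge is determined by its ends, so the vertex bijection carries the edges
    along. *)
Lemma isomorphic_of_adj (G K : multigraph) (h : vertex G -> vertex K) :
  simple G -> simple K -> bijective h ->
  (forall x y, x != y -> adj x y = adj (h x) (h y)) -> isomorphic G K.
Proof.
move=> [Gl Ginj] [Kl Kinj] hbij hadj.
have hinj := bij_inj hbij; have [h' hK h'K] := hbij.
have ends2 (L : multigraph) (e : edge L) : loopless L ->
    exists x y, x != y /\ ends e = [set x; y].
  move=> Ll; apply/cards2P.
  by have := Ll e; have := ends_card e; rewrite /is_loop; lia.
have img (e : edge G) : {e' : edge K | ends e' == h @: ends e}.
  apply: sigW; have [x [y [xy eE]]] := ends2 _ e Gl.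
  have : adj (h x) (h y) by rewrite -hadj //; apply/existsP; exists e; rewrite eE.
  by case/existsP=> e' /eqP e'E; exists e'; rewrite e'E eE imsetU !imset_set1.
pose g e := sval (img e).
have gE e : ends (g e) = h @: ends e by apply/eqP: (svalP (img e)).
exists h, g; split=> //; apply: inj_card_bij => [e f ef|].
  by apply/Ginj/(imset_inj hinj); rewrite -!gE ef.
(* What is left is that [K] has no more edges than [G], which follows from surjectivity of [g]. *)
suff sub : [set: edge K] \subset g @: setT.
  by rewrite -cardsT (leq_trans (subset_leq_card sub)) // -cardsT leq_imset_card.
apply/subsetP=> e' _; have [x [y [xy e'E]]] := ends2 _ e' Kl.
have : adj (h' x) (h' y).
  rewrite hadj ?h'K; last by apply: contraNneq xy => /(can_inj h'K)->.
  by apply/existsP; exists e'; rewrite e'E.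
case/existsP=> e /eqP eE; apply/imsetP; exists e => //; apply: Kinj.
by rewrite gE eE imsetU !imset_set1 !h'K.
Qed.

Lemma complete_graph_simple n : simple (complete_graph n).
Proof.
split=> [e|]; last exact: val_inj.
by rewrite /is_loop (eqP (valP e : #|val e| == 2)).
Qed.

Lemma complete_bipartite_graph_simple m n :
  simple (complete_bipartite_graph m n).
Proof.
split=> [e|[i j] [i' j'] /setP eE]; first by rewrite /is_loop /= cards2.
have /esym := eE (inr j); have /esym := eE (inl i); rewrite !inE !eqxx ?orbT.
by case/orP=> // /eqP[->] /orP[] // /eqP[->].
Qed.

Lemma isomorphic_complete_graph4 (G : multigraph) :
  cubic G -> simple G -> #|vertex G| = 4 ->
  isomorphic G (complete_graph 4).
Proof.
move=> G3 Gs cV.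
apply: (@isomorphic_of_adj _ (complete_graph 4)
          (fun v => cast_ord cV (enum_rank v))) => //.
- exact: complete_graph_simple.
- exact: bijective_cast_enum_rank.
move=> x y xy.
have -> : adj x y.
  suff : y \in neighbours x by rewrite inE.
  have -> : neighbours x = [set~ x]; last by rewrite !inE eq_sym.
  apply/eqP; rewrite eqEcard card_neighbours // cardsC1 cV leqnn andbT.
  by apply/subsetP=> z; rewrite !inE eq_sym; apply: adj_neq; case: Gs.
apply/esym/existsP.
set A := [set _; _]; have A2 : #|A| == 2.
  by rewrite cards2 (inj_eq (@cast_ord_inj _ _ _)) (inj_eq enum_rank_inj) xy.
by exists (exist _ A A2).
Qed.

Definition triangle_free (G : multigraph) :=
  forall x y z : vertex G, adj x y -> adj y z -> ~~ adj z x.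

Lemma triangle_free_neighbours (G : multigraph) (x y : vertex G) :
  triangle_free G -> adj x y -> neighbours y \subset ~: neighbours x.
Proof.
move=> Gt xy; apply/subsetP=> z; rewrite !inE => /(Gt _ _ _ xy).
by rewrite adj_sym.
Qed.

Lemma triangle_free_card (G : multigraph) (x : vertex G) :
  cubic G -> simple G -> triangle_free G -> 6 <= #|vertex G|.
Proof.
move=> G3 Gs Gt; have Nx := card_neighbours x G3 Gs.
have /card_gt0P[y] : 0 < #|neighbours x| by rewrite Nx.
rewrite inE => /(triangle_free_neighbours Gt)/subset_leq_card.
by rewrite card_neighbours // -(cardsC (neighbours x)) Nx; lia.
Qed.

Lemma isomorphic_complete_bipartite33 (G : multigraph) :
  cubic G -> simple G -> triangle_free G -> #|vertex G| = 6 ->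
  isomorphic G (complete_bipartite_graph 3 3).
Proof.
move=> G3 Gs Gt cV; have [Gl Ginj] := Gs.
have /card_gt0P[x _] : 0 < #|vertex G| by rewrite cV.
(* The sides are [B] and its complement, both of size three; a neighbourhood contained in a side
   fills it. *)
set B := neighbours x; have cB : #|B| = 3 by apply: card_neighbours.
have cA : #|~: B| = 3 by have := cardsC B; rewrite cB cV; lia.
have NB y : y \in B -> neighbours y = ~: B.
  move=> yB; apply/eqP; rewrite eqEcard cA card_neighbours // leqnn andbT.
  by apply: triangle_free_neighbours => //; rewrite inE in yB.
have NA y : y \in ~: B -> neighbours y = B.
  move=> yA; apply/esym/eqP; rewrite eqEcard cB card_neighbours // leqnn andbT.
  by apply/subsetP=> z zB; rewrite inE adj_sym; rewrite -(NB z zB) inE in yA.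
have adjE y z : adj y z = ((y \in B) != (z \in B)).
  have -> : adj y z = (z \in neighbours y) by rewrite inE.
  case: (boolP (y \in B)) => yB; first by rewrite NB // in_setC; case: (z \in B).
  by rewrite NA ?in_setC //; case: (z \in B).
pose h (s : 'I_3 + 'I_3) : vertex G :=
  match s with
  | inl i => enum_val (cast_ord (esym cB) i)
  | inr j => enum_val (cast_ord (esym cA) j)
  end.
have hB s : (h s \in B) = if s is inl _ then true else false.
  case: s => i /=; first exact: enum_valP.
  by apply/negbTE; rewrite -in_setC; apply: enum_valP.
have hinj : injective h.
  move=> s t st; have := hB s; rewrite st hB; case: s t st => i [] j //=.
    by move/enum_val_inj/cast_ord_inj=> ->.
  by move/enum_val_inj/cast_ord_inj=> ->.
have [|h' h'K hK] := inj_card_bij hinj.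
  by rewrite card_sum !card_ord cV.
apply: (@isomorphic_of_adj _ (complete_bipartite_graph 3 3) h') => //.
- exact: complete_bipartite_graph_simple.
- by exists h.
move=> x0 y _; rewrite adjE -{1}(hK x0) -{1}(hK y) !hB.
apply/idP/existsP.
  case: (h' x0) (h' y) => i [] j // _; first by exists (i, j).
  by exists (j, i); rewrite /= setUC.
case=> -[i j] /eqP/= /setP E; have := E (h' x0); have := E (h' y).
rewrite !inE !eqxx ?orbT => /orP[]/eqP Ey /orP[]/eqP Ex; rewrite Ex Ey //.
  (* In the two remaining cases [h' x0] and [h' y] coincide, so the edge would have a single end. *)
  by have := E (inr j); rewrite Ex Ey !inE !eqxx ?orbT orbb => /esym/eqP.
by have := E (inl i); rewrite Ex Ey !inE !eqxx ?orbT orbb => /esym/eqP.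
Qed.

(** * Cycles and shortest cycles *)

Lemma good_of_two_neighbours (G : multigraph) (S : {set vertex G}) :
  cubic G -> loopless G ->
  (forall v, v \in S -> exists y z,
     [/\ y != z, adj v y, adj v z, y \in S & z \in S]) ->
  good S.
Proof.
move=> G3 Gl S2; apply: good_of_two_edges => // v vS.
have [y [z [yz vy vz yS zS]]] := S2 v vS; have vNy := adj_neq Gl vy.
case/existsP: vy vz => e /eqP eE /existsP[f /eqP fE]; exists e, f.
rewrite !inE eE fE !subUset !sub1set vS yS zS !set21; split=> //.
apply/eqP=> ef; move: fE; rewrite -ef eE => /setP/(_ y).
by rewrite !inE eqxx orbT (negPf yz) orbF eq_sym (negPf vNy).
Qed.

(** With [v] rotated to the front, the second and the last vertex serve; they differ because the
    length exceeds two. *)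
Lemma ucycle_two_neighbours (G : multigraph) (c : seq (vertex G)) v :
  ucycle (@adj G) c -> 2 < size c -> v \in c ->
  exists y z, [/\ y != z, adj v y, adj v z, y \in c & z \in c].
Proof.
move=> cc c3 vc; have [i s sE] := rot_to vc.
rewrite -(rot_ucycle i) sE in cc; rewrite -(size_rot i) sE /= in c3.
have cE u : u \in s -> u \in c by rewrite -(mem_rot i c) sE inE orbC => ->.
case: s {sE} cc c3 cE => [|y s] //; case/lastP: s => [|s z] //.
rewrite /ucycle => /andP[/=/andP[vy]]; rewrite rcons_path => /andP[_].
rewrite last_rcons => zv /andP[_ /andP[ys _]] _ cE.
exists y, z; split=> //.
- by apply: contraNneq ys => ->; rewrite mem_rcons mem_head.
- by rewrite adj_sym.
- by apply: cE; rewrite mem_head.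
- by apply: cE; rewrite inE mem_rcons mem_head orbT.
Qed.

(** Extend a path at its front by a neighbour other than its second vertex: it grows or closes a
    cycle, and it cannot outgrow the vertex set. *)
Lemma exists_ucycle (G : multigraph) (x0 : vertex G) :
  loopless G -> (forall x : vertex G, 1 < #|neighbours x|) ->
  exists2 c, ucycle (@adj G) c & 2 < size c.
Proof.
move=> Gl N2.
have step n : (exists2 c, ucycle (@adj G) c & 2 < size c) \/
    exists x p, [/\ path (@adj G) x p, uniq (x :: p) & size p = n].
  elim: n => [|n [|[x [p [xp up sp]]]]]; [by right; exists x0, [::]|by left|].
  (* For an empty [p] the default [x] excludes nothing, as [x] is not its own neighbour. *)
  have /card_gt0P[z] : 0 < #|neighbours x :\ head x p|.
    by have := cardsD1 (head x p) (neighbours x); have := N2 x; lia.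
  rewrite !inE => /andP[zh xz].
  have [zp|zp] := boolP (z \in p); last first.
    right; exists z, (x :: p); rewrite /= adj_sym xz xp sp inE eq_sym.
    by rewrite (negPf (adj_neq Gl xz)) zp.
  left; case/splitPr: zp xp up zh {sp} => p1 p2.
  rewrite -cat_rcons cat_path -cat_cons cat_uniq => /andP[xp _] /andP[up _] zh.
  exists (x :: rcons p1 z); last first.
    (* [p1] is nonempty since [z] is not the head, so the cycle has at least three vertices. *)
    by case: p1 zh {xp up} => [|a p1]; rewrite /= ?eqxx // size_rcons.
  by rewrite /ucycle up andbT /= rcons_path xp last_rcons adj_sym.
case: (step #|vertex G|) => // -[x [p [_ up sp]]].
by have := max_card (mem (x :: p)); rewrite (card_uniqP up) /= sp ltnn.
Qed.

Lemma exists_shortest_ucycle (G : multigraph) (x0 : vertex G) :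
  loopless G -> (forall x : vertex G, 1 < #|neighbours x|) ->
  exists c, [/\ ucycle (@adj G) c, 2 < size c &
    forall c', ucycle (@adj G) c' -> 2 < size c' -> size c <= size c'].
Proof.
move=> Gl N2.
(* Tuples of fixed length make the predicate decidable, as taking a minimum requires. *)
pose P n := (2 < n) && [exists t : n.-tuple (vertex G), ucycleb (@adj G) t].
have PP c : ucycle (@adj G) c -> 2 < size c -> P (size c).
  by move=> cc c3; rewrite /P c3; apply/existsP; exists (in_tuple c).
have exP : exists n, P n.
  by have [c cc c3] := exists_ucycle x0 Gl N2; exists (size c); apply: PP.
case: (ex_minnP exP) => n /andP[n3 /existsP[t tc]] nmin.
exists t; rewrite size_tuple; split=> // c' cc c3; exact/nmin/PP.
Qed.

(** If distinct, [x] and [y] split the cycle into arcs [p1] and [p2]. Closing each through [w] gives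
    cycles of lengths [size p1 + 3] and [size p2 + 3]; both are at least [size p1 + size p2 + 2]
    only if the latter is at most 4. *)
Lemma shortest_ucycle_closed (G : multigraph) (c : seq (vertex G)) w x y :
  ucycle (@adj G) c -> 4 < size c ->
  (forall c', ucycle (@adj G) c' -> 2 < size c' -> size c <= size c') ->
  w \notin c -> x \in c -> y \in c -> adj w x -> adj w y -> x = y.
Proof.
move=> cc c5 cmin wc xc yc wx wy; apply/eqP/idPn => xNy.
have [i s sE] := rot_to xc.
rewrite -(rot_ucycle i) sE in cc; rewrite -(mem_rot i) sE inE eq_sym in yc.
rewrite (negPf xNy) /= in yc; rewrite -(mem_rot i) sE in wc.
rewrite -(size_rot i) sE in cmin c5.
case/splitPr: yc {sE} cc c5 cmin wc => p1 p2.
rewrite /ucycle /= rcons_cat cat_path /= => /andP[/and3P[xp1 py yp2]].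
rewrite mem_cat cat_uniq /= inE => /and5P[xp up1 hp yp up2] c5 cmin wc.
move: xp wc hp; rewrite !(inE, mem_cat) !negb_or.
move=> /and3P[xp1' xy' xp2'] /and4P[wNx wp1 wNy wp2] /andP[yp1 _].
have := cmin [:: w, x & rcons p1 y]; have := cmin [:: w, y & rcons p2 x].
rewrite /= !size_rcons size_cat /= => h2 h1.
suff : (size p1 + (size p2).+1 < (size p1).+3) /\
       (size p1 + (size p2).+1 < (size p2).+3).
  by move: c5; rewrite /= size_cat /=; clear; lia.
split; [apply: h1 | apply: h2] => //.
  rewrite wx rcons_path rcons_path xp1 py last_rcons adj_sym wy.
  rewrite !(inE, mem_rcons, rcons_uniq) !negb_or wNx wNy wp1 xy' xp1'.
  by rewrite yp1 up1.
rewrite wy rcons_path yp2 last_rcons adj_sym wx.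
rewrite !(inE, mem_rcons, rcons_uniq) !negb_or wNx wNy wp2 (eq_sym y) xy' xp2'.
by rewrite yp up2.
Qed.

(** A third neighbour of [x] on the cycle would give a chord, which cuts off a shorter cycle. *)
Lemma shortest_ucycle_proper (G : multigraph) (c : seq (vertex G)) x :
  ucycle (@adj G) c -> 2 < size c ->
  (forall c', ucycle (@adj G) c' -> 2 < size c' -> size c <= size c') ->
  loopless G -> x \in c -> 2 < #|neighbours x| ->
  exists y, y \notin c.
Proof.
move=> cc c3 cmin Gl xc N3; have [i s sE] := rot_to xc.
have cE := mem_rot i c; rewrite sE in cE.
rewrite -(rot_ucycle i) sE in cc; rewrite -(size_rot i) sE in cmin.
(* With [x] in front, its neighbours along the cycle are the head and the last entry of [s]; [t] is
   a third one. *)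
have /card_gt0P[t] : 0 < #|neighbours x :\: [set head x s; last x s]|.
  have := cardsID [set head x s; last x s] (neighbours x).
  have := subset_leq_card (subsetIr (neighbours x) [set head x s; last x s]).
  by rewrite cards2; case: (_ == _) => /=; lia.
rewrite !inE negb_or => /andP[/andP[th tl] xt].
exists t; rewrite -cE inE eq_sym (negPf (adj_neq Gl xt)) /=.
apply/negP=> ts; case/splitPr: ts cc cmin th tl {sE cE} => p1 p2.
rewrite /ucycle -cat_rcons -cat_cons cat_uniq => /andP[xp /andP[up _]].
move: xp; rewrite /= rcons_cat cat_path => /andP[xp _].
move=> /(_ (x :: rcons p1 t)); rewrite /ucycle /= rcons_path xp last_rcons.
rewrite adj_sym xt (up : (_ \notin _) && _) size_cat size_rcons last_cat last_rcons => cmin th tl.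
(* [p1] nonempty gives the shortcut at least three vertices; [p2] nonempty makes it strictly shorter
   than the cycle. *)
case: p1 th cmin {xp up} => [|a p1] /=; first by rewrite eqxx.
move=> _ /(_ isT isT); case: p2 tl => [|b p2] /=; first by rewrite eqxx.
by move=> _; lia.
Qed.

(** * Case analysis on loops, parallel edges and the girth *)

Theorem theorem9 (H : multigraph)
  (H_2ec : edge_connected 2 H)
  (H_cubic : cubic H)
  (H_not_S2 : ~ isomorphic H S2)
  (H_not_K4 : ~ isomorphic H (complete_graph 4))
  (H_not_K33 : ~ isomorphic H (complete_bipartite_graph 3 3)) :
  decomposable H.
Proof.
have [V2 Hdel] := H_2ec.
have Hc : connected H.
  (* Deleting no edge changes the edge type but not adjacency. *)
  rewrite /connected -[RHS](Hdel set0) ?cards0 //; apply: eq_n_comp => x y.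
  apply: eq_connect => {}x {}y; apply/existsP/existsP => -[e eE].
    have e0 : e \notin set0 by rewrite inE.
    by exists (exist _ e e0).
  by exists (val e).
have [/existsP[e el]|] := boolP [exists e : edge H, is_loop e].
  exact: loop_decomposable el.
rewrite negb_exists => /forallP Hl.
have [/injectiveP Hinj|] := boolP (injectiveb (@ends H)); last first.
  case/injectivePn=> e [f ef eqef]; exact: parallel_decomposable eqef _.
have Hs : simple H by [].
have N3 (x : vertex H) := card_neighbours x H_cubic Hs.
have /card_gt0P[x0 _] : 0 < #|vertex H| by apply: ltnW.
have [|c [cc c3 cmin]] := exists_shortest_ucycle x0 Hl.
  by move=> x; rewrite N3.
pose S := [set x in c].
have Sg : good S.
  apply: good_of_two_neighbours => // v; rewrite inE.
  case/(ucycle_two_neighbours cc c3) => y [z [yz vy vz yc zc]].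
  by exists y, z; rewrite !inE.
have cS : #|S| = size c.
  by rewrite cardsE; apply/card_uniqP; case/andP: cc.
have S0 : S != set0 by rewrite -card_gt0 cS; lia.
have bS := card_boundary_good Sg.
have V4 : 3 < #|vertex H|.
  have : neighbours x0 \subset [set~ x0].
    by apply/subsetP=> y; rewrite !inE eq_sym; apply: adj_neq.
  by move/subset_leq_card; rewrite N3 cardsC1; lia.
have [c4|c5] := leqP (size c) 4; last first.
  apply: (@boundary_decomposable _ S) => //.
    have /card_gt0P[x xS] : 0 < #|S| by rewrite card_gt0.
    have [||y yc] := @shortest_ucycle_proper _ c x cc c3 cmin Hl.
    - by rewrite inE in xS.
    - by rewrite N3.
    by apply: contraNneq yc => /setP/(_ y); rewrite !inE.
  (* For [w] outside, two crossing edges reach the same cycle vertex, hence are equal by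
     simplicity. *)
  move=> w; have [/Sg //|wS] := boolP (w \in S).
  apply/card_le1_eqP => e f.
  have other g : g \in incident w :&: boundary S ->
      exists2 x, x \in c & ends g = [set w; x].
    rewrite in_setI [g \in incident w]inE => /andP[wg /boundaryP[x [y [gE]]]].
    rewrite inE => xc yS; exists x => //; move: wg; rewrite gE !inE.
    case/predU1P => [wx|/eqP->]; last by rewrite setUC.
    by rewrite wx inE xc in wS.
  move=> /other[x xc eE] /other[y yc fE]; apply: Hinj; rewrite eE fE.
  rewrite inE in wS.
  rewrite (shortest_ucycle_closed cc c5 cmin wS xc yc) //; apply/existsP.
    by exists e; rewrite eE.
  by exists f; rewrite fE.
(* Taking [d = size c - 2] turns the bound [d.+2] on the boundary into [size c]. *)
have [Hlarge|Hsmall] := ltnP (#|S| + (size c - 2)) #|vertex H|.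
  by apply: (@good_decomposable _ (size c - 2) S) => //; lia.
(* [Hsmall] leaves at most four vertices for length three and six for length four; [V4] and
   triangle-freeness give the matching lower bounds. *)
have [{}c3|{}c4] : size c = 3 \/ size c = 4 by lia.
  by case: H_not_K4; apply: isomorphic_complete_graph4 => //; lia.
have Ht : triangle_free H.
  move=> x y z xy yz; apply/negP=> zx; have := cmin [:: x; y; z].
  rewrite c4 /ucycle /= xy yz zx !inE negb_or (adj_neq Hl xy) (adj_neq Hl yz).
  by rewrite eq_sym (adj_neq Hl zx) => /(_ isT isT).
case: H_not_K33; apply: isomorphic_complete_bipartite33 => //.
by have := triangle_free_card x0 H_cubic Hs Ht; lia.
Qed.
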